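(* Let $G_\phi$ be a signed graph with sink $q$ and connected underlying graph $G$, let $L=L_{G_\phi}$ be its reduced signed Laplacian and $M=L_G$ the reduced Laplacian of $G$. Let $\vec{c}\in S^+$ be a valid configuration for $(L,M)$. Then $\vec{c}$ is $z$-superstable for $G_\phi$ if and only if $\lfloor ML^{-1}\vec{c}\rfloor$ is superstable for $G$. Similarly, $\vec{c}$ is critical for $G_\phi$ if and only if $\lfloor ML^{-1}\vec{c}\rfloor$ is critical for $G$.
   Context: A signed graph $G_\phi$ is a finite simple graph $G=(V,E)$ with a sign function $\phi:E\to\{+,-\}$. A vertex $q$ is chosen as sink and $v_1,\dots,v_n$ are the other (nonsink) vertices. The reduced signed Laplacian $L=L_{G_\phi}$ is the $n\times n$ matrix with $L_{ii}=\deg_G(v_i)$ (counting edges to $q$) and, for $i\neq j$, $L_{ij}=-1$ if $v_iv_j$ is a positive edge, $+1$ if it is a negative edge, $0$ if it is not an edge. $M=L_G$ is the same matrix for the all-positive signing, i.e. the usual reduced Laplacian of $G$. With $G$ connected, both are invertible and $M^{-1}$ has nonnegative entries. For a pair $(L,M)$ the valid configurations are $S^+=\{\vec{c}\in\mathbb{Z}^n: ML^{-1}\vec{c}\ge\vec{0}\}$. For $\vec{c}\in S^+$: site $i$ is ready to fire if $\vec{c}-L\vec{e}_i\in S^+$; $\vec{c}$ is stable if no site is ready to fire; $\vec{c}$ is $z$-superstable if $\vec{c}-L\vec{z}\notin S^+$ for all nonzero $\vec{z}\in\mathbb{Z}^n_{\ge0}$; $\vec{c}$ is reachable if there is $\vec{d}\in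 S^+$ with $\vec{d}-L\vec{e}_i\in S^+$ for all $i$ and a finite sequence $i_1,\dots,i_k$ with $\vec{c}=\vec{d}-\sum_{j=1}^kL\vec{e}_{i_j}$ and all partial results $\vec{d}-\sum_{j=1}^{\ell}L\vec{e}_{i_j}$, $\ell\le k$, in $S^+$; $\vec{c}$ is critical if it is stable and reachable. These notions for $G_\phi$ use $(L,M)=(L_{G_\phi},L_G)$. ''Critical for $G$'' is the same notion for the pair $(L_G,L_G)$, whose valid configurations are $\mathbb{Z}^n_{\ge0}$. A configuration $\vec{b}\in\mathbb{Z}^n_{\ge0}$ is superstable for $G$ if $\vec{b}-L_G\vec{\chi}\notin\mathbb{Z}^n_{\ge0}$ for every nonzero $\vec{\chi}\in\{0,1\}^n$. $\lfloor\cdot\rfloor$ is the entrywise floor. *)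

(* Defs.v *)
From mathcomp Require Import all_boot all_order all_algebra.

Set Implicit Arguments.
Unset Strict Implicit.
Unset Printing Implicit Defensive.

Import Order.TTheory GRing.Theory Num.Theory.
Local Open Scope ring_scope.

Inductive sign := Plus | Minus.

Record simple_graph (V : finType) := SimpleGraph {
  adj : rel V;
  adj_sym : symmetric adj;
  adj_irr : irreflexive adj }.

(* [sgn u v] is the sign of the edge uv; its values on non-adjacent pairs are
   irrelevant. *)
Record signed_graph (V : finType) := SignedGraph {
  underlying :> simple_graph V;
  sgn : V -> V -> sign;
  sgn_sym : forall u v, adj underlying u v -> sgn u v = sgn v u }.

Definition all_positive (V : finType) (G : simple_graph V) : signed_graph V :=
  @SignedGraph V G (fun _ _ => Plus) (fun _ _ _ => erefl).

Definition connected (V : finType) (G : simple_graph V) : Prop :=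
  forall u v, connect (adj G) u v.

Definition degree (V : finType) (G : simple_graph V) (u : V) : nat :=
  #|[set w | adj G u w]|.

Definition enumerates_nonsinks (V : finType) (q : V) (n : nat)
    (v : 'I_n -> V) : Prop :=
  injective v /\ forall u, (u \in codom v) = (u != q).

Definition reduced_laplacian (V : finType) (G : signed_graph V) (n : nat)
    (v : 'I_n -> V) : 'M[int]_n :=
  \matrix_(i, j)
    if i == j then (degree G (v i))%:Z
    else if adj G (v i) (v j) then
      match sgn G (v i) (v j) with Plus => -1 | Minus => 1 end
    else 0.

Definition nonneg (R : numDomainType) (n : nat) (x : 'cV[R]_n) : Prop :=
  forall i, 0 <= x i 0.

Section Pair.
Variables (n : nat) (L M : 'M[int]_n).
Implicit Types c d : 'cV[int]_n.

(* M L^-1 c, computed over the rationals. [invmx A] is [A] itself when [A] is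
   singular, so this is meaningful only for invertible [L]. *)
Definition MLinv c : 'cV[rat]_n :=
  map_mx intr M *m invmx (map_mx intr L) *m map_mx intr c.

Definition valid c : Prop := nonneg (MLinv c).

Definition fire c (i : 'I_n) : 'cV[int]_n := c - L *m delta_mx i 0.

Definition ready c (i : 'I_n) : Prop := valid (fire c i).

Definition stable c : Prop := valid c /\ forall i, ~ ready c i.

Definition z_superstable c : Prop :=
  valid c /\
  forall z : 'cV[int]_n, nonneg z -> z <> 0 -> ~ valid (c - L *m z).

Definition reachable c : Prop :=
  exists d, [/\ valid d, forall i, ready d i &
    exists2 s : seq 'I_n, c = foldl fire d s &
      forall l, (l <= size s)%N -> valid (foldl fire d (take l s))].

Definition critical c : Prop := stable c /\ reachable c.

End Pair.

(* Superstability for an unsigned graph with reduced Laplacian [M]: only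
   nonzero 0/1-vectors are fired. *)
Definition superstable (n : nat) (M : 'M[int]_n) (b : 'cV[int]_n) : Prop :=
  nonneg b /\
  forall chi : 'cV[int]_n, (forall i, chi i 0 = 0 \/ chi i 0 = 1) ->
    chi <> 0 -> ~ nonneg (b - M *m chi).

Definition floor_cV (n : nat) (x : 'cV[rat]_n) : 'cV[int]_n :=
  map_mx Num.floor x.

(* Main.v *)
Require Import Defs.
From mathcomp Require Import all_boot all_order all_algebra.

(** Send a configuration [c] to its shadow, the integer vector
    [floor (M L^-1 c)]. Subtracting [L z] from [c] subtracts the integer vector
    [M z] from [M L^-1 c], so the floor changes by exactly [- M z]; and a
    rational vector is nonnegative iff its floor is. Hence firing commutes with
    taking shadows ([shadowB]), and [c] is valid iff its shadow is a nonnegative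
    configuration of [G] ([valid_shadow]).

    Stability therefore transfers at once. A reachability certificate
    transfers too: pushing one forward is immediate, and to pull one back along
    a firing sequence [s] in [G], start from [c + L e], where [e] counts the
    firings in [s]; its shadow is forced to be the given starting configuration
    of [G] ([reachable_shadow]).

    For superstability the shadow translates firing an arbitrary nonnegative
    [z] in the signed graph into firing the same [z] in [G], whereas
    superstability of [G] tests only 0/1 vectors. The gap is closed by firing
    just the set where [z] is maximal ([fire_max_set]).

    All of this needs [L] to be invertible over the rationals, which follows
    from a maximum principle: the signs do not affect absolute values, so for
    [x] in the kernel the set of vertices where [|x|] is maximal is closed
    under adjacency, and by connectedness it contains the sink, where [x] is
    extended by 0 ([laplacian_unit]). *)

Set Implicit Arguments.
Unset Strict Implicit.
Unset Printing Implicit Defensive.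

Import Order.TTheory GRing.Theory Num.Theory.
Local Open Scope ring_scope.

Section Laplacian.
Variables (V : finType) (G : signed_graph V) (q : V) (n : nat) (v : 'I_n -> V).
Hypothesis vP : enumerates_nonsinks q v.
Local Notation L := (reduced_laplacian G v).

Lemma sum_vertices (R : nmodType) (F : V -> R) :
  \sum_u F u = F q + \sum_j F (v j).
Proof.
have [v_inj v_codom] := vP.
rewrite (bigD1 q) //=; congr (_ + _).
rewrite -(big_image _ _ _ predT F) [RHS]big_uniq /=; last first.
  by rewrite map_inj_uniq ?enum_uniq.
by apply: eq_bigl => u; rewrite v_codom.
Qed.

(** Extension by zero to the sink: it lets edges to the sink be treated like
    all others, so that the Laplacian acts by a sum over neighbors. *)
Definition extend0 (R : nmodType) (x : 'cV[R]_n) (u : V) : R :=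
  \sum_(i | v i == u) x i 0.

Lemma extend0_v (R : nmodType) (x : 'cV[R]_n) i : extend0 x (v i) = x i 0.
Proof.
have [v_inj _] := vP.
by rewrite /extend0 (big_pred1 i) // => j; rewrite (inj_eq v_inj).
Qed.

Lemma extend0_q (R : nmodType) (x : 'cV[R]_n) : extend0 x q = 0.
Proof.
have [_ v_codom] := vP; rewrite /extend0 big_pred0 // => j.
by apply/negbTE; rewrite -v_codom codom_f.
Qed.

Definition sign_val (R : pzRingType) (s : sign) : R :=
  match s with Plus => 1 | Minus => -1 end.

Lemma norm_sign_val (R : numDomainType) s : `|sign_val R s| = 1.
Proof. by case: s; rewrite ?normrN normr1. Qed.

Lemma nonsinkP u : u != q -> exists i, u = v i.
Proof. by have [_ <-] := vP => /codomP. Qed.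

(** The diagonal entry counts the neighbors, the sink included, so it can be
    distributed over them; the sink then contributes [x i 0 - 0]. *)
Lemma laplacian_mul (R : comPzRingType) (x : 'cV[R]_n) i :
  (map_mx intr L *m x) i 0
    = \sum_(u | adj G (v i) u) (x i 0 - sign_val R (sgn G (v i) u) * extend0 x u).
Proof.
rewrite sumrB sumr_const.
have -> : #|adj G (v i)| = degree G (v i) by rewrite /degree cardsE.
rewrite [X in _ - X]big_mkcond /= sum_vertices extend0_q mulr0 if_same add0r.
rewrite mxE (bigD1 i) //= [in RHS](bigD1 i) //= !mxE eqxx adj_irr add0r.
rewrite -pmulrn mulr_natl; congr (_ + _).
rewrite -sumrN; apply: eq_bigr => j ji; rewrite !mxE extend0_v.
rewrite eq_sym (negbTE ji); case: ifP => _; last by rewrite mulr0z mul0r oppr0.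
by case: (sgn _ _ _); rewrite /= ?mulrN1z ?mulr1z ?mulN1r ?mul1r ?opprK.
Qed.

(** The maximum principle: if [L x = 0], then at a vertex where [|x|] is
    maximal, [deg * |x|] is at most the sum of [|x|] over the neighbors, which
    forces the maximum at each of them. Connectedness spreads the maximum to the
    sink, so it is 0. *)
Lemma laplacian_unit (Gconn : connected G) :
  (map_mx intr L : 'M[rat]_n) \in unitmx.
Proof.
rewrite -unitmx_tr -row_free_unit; apply: inj_row_free => y.
move/(congr1 trmx); rewrite trmx_mul trmxK trmx0 => Ly0.
suff y0 : y^T = 0 by rewrite -[y]trmxK y0 trmx0.
move: y^T Ly0 => {y} x Lx0; pose X := extend0 x.
have [u0 _ maxX] := @arg_maxP _ _ V q predT (fun u => `|X u|) isT.
pose A : {pred V} := [pred u | `|X u| == `|X u0|].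
have [X0|Xn0] := eqVneq `|X u0| 0.
  apply/matrixP => i j; rewrite ord1 mxE -extend0_v -/X.
  by apply/eqP; rewrite -normr_le0 -X0; apply: maxX.
have A_closed : closed (adj G) A.
  apply: intro_closed; first exact: (sym_connect_sym (@adj_sym _ G)).
  move=> u w uw /eqP Xu; rewrite inE.
  have /nonsinkP[i ui] : u != q.
    by apply: contraNneq Xn0 => uq; rewrite -Xu uq /X extend0_q normr0.
  subst u.
  have gap_ge0 z : adj G (v i) z -> 0 <= `|X (v i)| - `|X z|.
    by move=> _; rewrite Xu subr_ge0; apply: maxX.
  have gap_eq0 : \sum_(z | adj G (v i) z) (`|X (v i)| - `|X z|) = 0.
    apply/eqP; rewrite eq_le sumr_ge0 // andbT sumrB subr_le0.
    have /eqP := congr1 (fun y : 'cV_n => y i 0) Lx0.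
    rewrite laplacian_mul mxE sumrB subr_eq0 => /eqP sumE.
    rewrite [leLHS]sumr_const -normrMn -sumr_const /X extend0_v sumE.
    apply: le_trans (ler_norm_sum _ _ _) _; apply: ler_sum => z _.
    by rewrite normrM norm_sign_val mul1r.
  have /psumr_eq0P/(_ gap_eq0 w uw)/eqP := gap_ge0.
  by rewrite subr_eq0 Xu eq_sym.
have := closed_connect A_closed (Gconn u0 q).
by rewrite !inE eqxx /X extend0_q normr0 eq_sym (negbTE Xn0).
Qed.

End Laplacian.

(** The witness is the indicator [chi] of the set where [z] attains its maximum,
    which is positive. A site outside this set only receives chips when [chi] is
    fired. A site inside it loses one chip per neighbor outside, and firing [z]
    costs it at least that much, because [z] is an integer vector and drops by
    at least 1 along each such edge (edges to the sink included). *)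
Lemma fire_max_set (V : finType) (G : simple_graph V) (q : V) (n : nat)
    (v : 'I_n -> V) (vP : enumerates_nonsinks q v) (b z : 'cV[int]_n) :
  let M := reduced_laplacian (all_positive G) v in
  nonneg b -> nonneg z -> z <> 0 -> nonneg (b - M *m z) ->
  exists2 chi : 'cV[int]_n, (forall i, chi i 0 = 0 \/ chi i 0 = 1) /\ chi <> 0 &
    nonneg (b - M *m chi).
Proof.
move=> M b_ge0 z_ge0 z_neq0 bz_ge0.
have [i0 zi0] : exists i0, z i0 0 != 0.
  apply/existsP; apply: contra_notT z_neq0 => /existsPn z0.
  by apply/matrixP => i j; rewrite ord1 mxE; apply/eqP; rewrite -[_ == _]negbK z0.
have [i1 _ maxz] := @arg_maxP _ _ 'I_n i0 predT (fun i => z i 0) isT.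
have m_gt0 : 0 < z i1 0 by apply: lt_le_trans (maxz i0 isT); rewrite lt0r zi0 z_ge0.
pose chi : 'cV[int]_n := \col_i (z i 0 == z i1 0)%:Z.
have chi_ext u : extend0 v chi u = (extend0 v z u == z i1 0)%:Z.
  have [->|/(nonsinkP vP)[i ->]] := eqVneq u q; last by rewrite !(extend0_v vP) mxE.
  by rewrite !(extend0_q vP) lt_eqF.
have maxz_ext u : extend0 v z u <= z i1 0.
  have [->|/(nonsinkP vP)[i ->]] := eqVneq u q.
    by rewrite (extend0_q vP) ltW.
  by rewrite (extend0_v vP); apply: maxz.
have M_mul x i : (M *m x) i 0 = \sum_(u | adj G (v i) u) (x i 0 - extend0 v x u).
  have -> : M = map_mx intr M by rewrite map_mx_id // => k; rewrite intz.
  by rewrite (laplacian_mul (all_positive G) vP); under eq_bigr do rewrite mul1r.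
exists chi; first split.
- by move=> i; rewrite mxE; case: eqP; [right|left].
- by move=> /matrixP/(_ i1 0); rewrite !mxE eqxx.
have fire_ge0 x i : (0 <= (b - M *m x) i 0) = ((M *m x) i 0 <= b i 0).
  by rewrite mxE [X in _ + X]mxE subr_ge0.
move=> i; rewrite fire_ge0 M_mul.
have [zi|zi] := eqVneq (z i 0) (z i1 0).
  have := bz_ge0 i; rewrite fire_ge0 M_mul; apply: le_trans.
  apply: ler_sum => u _; rewrite mxE chi_ext zi eqxx.
  have [->|uz] := eqVneq (extend0 v z u) (z i1 0); first by rewrite !subrr.
  by rewrite subr0 -gtz0_ge1 subr_gt0 lt_neqAle uz maxz_ext.
apply: le_trans (b_ge0 i); apply: sumr_le0 => u _.
by rewrite mxE chi_ext (negbTE zi) sub0r oppr_le0.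
Qed.

Section FloorCorrespondence.
Variables (n : nat) (L M : 'M[int]_n).
Hypothesis L_unit : (map_mx intr L : 'M[rat]_n) \in unitmx.
Hypothesis M_unit : (map_mx intr M : 'M[rat]_n) \in unitmx.
Implicit Types (c d z b : 'cV[int]_n) (s : seq 'I_n).

Local Notation shadow c := (floor_cV (MLinv L M c)).

(** [M L^-1 (L z) = M z] is an integer vector, so it passes through the floor. *)
Lemma shadowB c z : shadow (c - L *m z) = shadow c - M *m z.
Proof.
rewrite /MLinv map_mxB map_mxM mulmxBr mulmxA mulmxKV // -map_mxM.
by apply/matrixP => i j; rewrite !mxE -intrN floorDrz ?intr_int // intrKfloor.
Qed.

Lemma shadow_fire c i : shadow (fire L c i) = fire M (shadow c) i.
Proof. exact: shadowB. Qed.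

Lemma shadow_foldl c s :
  shadow (foldl (fire L) c s) = foldl (fire M) (shadow c) s.
Proof. by elim: s c => //= i s IH c; rewrite IH shadow_fire. Qed.

Lemma valid_shadow c : valid L M c <-> nonneg (shadow c).
Proof.
have floor_nonneg (x : 'cV[rat]_n) : nonneg x <-> nonneg (floor_cV x).
  by split=> H i; have := H i; rewrite mxE floor_ge0.
exact: floor_nonneg.
Qed.

Lemma valid_unsigned b : valid M M b <-> nonneg b.
Proof.
rewrite /valid /MLinv mulmxV // mul1mx.
by split=> H i; have := H i; rewrite mxE ler0z.
Qed.

Lemma valid_shadow_unsigned c : valid L M c <-> valid M M (shadow c).
Proof. exact: iff_trans (valid_shadow c) (iff_sym (valid_unsigned _)). Qed.

Lemma ready_shadow c i : ready L M c i <-> ready M M (shadow c) i.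
Proof. by rewrite /ready -shadow_fire; apply: valid_shadow_unsigned. Qed.

Lemma stable_shadow c : stable L M c <-> stable M M (shadow c).
Proof.
split=> -[vc nr]; split=> [|i ri].
- exact: (valid_shadow_unsigned c).1 vc.
- exact: nr i ((ready_shadow c i).2 ri).
- exact: (valid_shadow_unsigned c).2 vc.
- exact: nr i ((ready_shadow c i).1 ri).
Qed.

Lemma foldl_fire (A : 'M[int]_n) c s :
  foldl (fire A) c s = c - A *m \sum_(i <- s) delta_mx i 0.
Proof.
elim: s c => [|i s IH] c /=; first by rewrite big_nil mulmx0 subr0.
by rewrite IH big_cons mulmxDr opprD addrA.
Qed.

(** Not every configuration of [G] is visibly a shadow, but one from which the
    shadow of [c] is reached has an explicit preimage: undo on [c] the firings
    that led there. *)
Lemma reachable_shadow c : reachable L M c <-> reachable M M (shadow c).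
Proof.
split=> [[d [vd rd [s cE vs]]]|[d' [vd rd [s cE vs]]]].
  exists (shadow d); split=> [|i|].
  - exact: (valid_shadow_unsigned d).1 vd.
  - exact: (ready_shadow d i).1 (rd i).
  - exists s => [|l /vs vl]; first by rewrite cE shadow_foldl.
    by rewrite -shadow_foldl; apply: (valid_shadow_unsigned _).1 vl.
(* [e] counts how often each site fires in [s]. *)
pose e := \sum_(i <- s) delta_mx i 0 : 'cV[int]_n.
have dE : shadow (c + L *m e) = d'.
  by rewrite -[L *m e]opprK -mulmxN shadowB cE foldl_fire mulmxN opprK subrK.
exists (c + L *m e); split=> [|i|].
- by apply: (valid_shadow_unsigned _).2; rewrite dE.
- by apply: (ready_shadow _ i).2; rewrite dE.
exists s => [|l /vs vl]; first by rewrite foldl_fire addrK.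
by apply: (valid_shadow_unsigned _).2; rewrite shadow_foldl dE.
Qed.

Lemma critical_shadow c : critical L M c <-> critical M M (shadow c).
Proof.
split=> -[sc rc]; split.
- exact: (stable_shadow c).1 sc.
- exact: (reachable_shadow c).1 rc.
- exact: (stable_shadow c).2 sc.
- exact: (reachable_shadow c).2 rc.
Qed.

End FloorCorrespondence.

Theorem corollary3p4 (V : finType) (G : signed_graph V) (q : V)
    (n : nat) (v : 'I_n -> V)
    (Gconn : connected G) (vP : enumerates_nonsinks q v)
    (L : 'M[int]_n) (defL : L = reduced_laplacian G v)
    (M : 'M[int]_n) (defM : M = reduced_laplacian (all_positive G) v)
    (c : 'cV[int]_n) (c_valid : valid L M c) :
  (z_superstable L M c <-> superstable M (floor_cV (MLinv L M c))) /\
  (critical L M c <-> critical M M (floor_cV (MLinv L M c))).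
Proof.
have L_unit : (map_mx intr L : 'M[rat]_n) \in unitmx.
  by rewrite defL; apply: laplacian_unit vP Gconn.
have M_unit : (map_mx intr M : 'M[rat]_n) \in unitmx.
  by rewrite defM; apply: (laplacian_unit (G := all_positive G)) vP Gconn.
have b_ge0 := (valid_shadow L M c).1 c_valid.
split; last exact: critical_shadow.
split=> -[_ no_fire]; split=> //.
  move=> chi chi01 chi0 bchi; apply: (no_fire chi) => //.
    by move=> i; case: (chi01 i) => ->.
  by apply: (valid_shadow L M _).2; rewrite shadowB.
move=> z z_ge0 z0 /(valid_shadow L M _).1; rewrite shadowB // => bz_ge0.
have := fire_max_set (G := G) vP b_ge0 z_ge0 z0; rewrite -defM.
by case/(_ bz_ge0) => chi [chi01 chi0]; apply: no_fire.
Qed.
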